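(* Let $\mathcal{G}$ be a compact group acting continuously on a sample space $\mathcal{Y}$. For each orbit $O \in \mathcal{Y}/\mathcal{G}$ let $\mathbb{Q}^O$ be a probability measure concentrated on $O$ (depending measurably on $O$), with Lebesgue decomposition $\mathbb{Q}^O = \mathbb{Q}^O_a + \mathbb{Q}^O_s$ with respect to $\mathrm{Unif}(O)$. Let $U : [0,\infty] \to [-\infty,\infty]$ be non-decreasing with $U(\infty) = \limsup_{x\to\infty}U(x)$. Let $\varepsilon^U : \mathcal{Y} \to [0,\infty]$ be measurable and such that for every orbit $O$: (i) $\mathbb{E}^{\mathrm{Unif}(O)}[\varepsilon^U] = 1$; (ii) for some $\lambda_O \geq 0$, $$\varepsilon^U(y) \in \operatorname*{argmax}_{x \in [0,\infty]} \frac{d\mathbb{Q}^O_a}{d\mathrm{Unif}(O)}(y)\, U(x) - \lambda_O x, \quad \mathrm{Unif}(O)\text{-a.s.};$$ and $\varepsilon^U = \infty$, $\mathbb{Q}^O_s$-a.s. Then $\varepsilon^U$ is an exact e-value for $\mathcal{G}$ invariance and is $U$-optimal against $\mathbb{Q}^\mu := \int \mathbb{Q}^O\, d\mu(O)$, for every probability measure $\mu$ on $\mathcal{Y}/\mathcal{G}$.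
   Context: All spaces are second-countable locally compact Hausdorff, equipped with their Borel $\sigma$-algebras. $\overline{G}$ follows the Haar probability measure on $\mathcal{G}$. The orbit of $y$ is $O_y = \{Gy : G \in \mathcal{G}\}$, $\mathcal{Y}/\mathcal{G}$ is the set of orbits; $\mathrm{Unif}(O)$ is the law of $\overline{G}y$ for any $y \in O$. A probability $\mathbb{P}$ is $\mathcal{G}$ invariant if $\mathbb{P}(G^{-1}A) = \mathbb{P}(A)$ for all $G, A$. A measurable $\varepsilon : \mathcal{Y} \to [0,\infty]$ is valid (exact) for $\mathcal{G}$ invariance if $\mathbb{E}^{\mathbb{P}}[\varepsilon] \leq 1$ ($=1$) for every $\mathcal{G}$ invariant probability $\mathbb{P}$. The objective in (ii) at $x=\infty$ is understood as its limsup as $x\to\infty$, and $0\cdot(\pm\infty)=0$. For a probability $\mathbb{Q}$ on $\mathcal{Y}$, let $\overline{\mathbb{Q}}(A) = \mathbb{E}_{\overline{G}}[\mathbb{Q}(\overline{G}^{-1}A)]$ be its group average and $\mathbb{Q} = \mathbb{Q}_a + \mathbb{Q}_s$ its Lebesgue decomposition with respect to $\overline{\mathbb{Q}}$. An e-value $\varepsilon^*$ that is valid for $\mathcal{G}$ invariance, with $\varepsilon^* = \infty$ $\mathbb{Q}_s$-a.s., is $U$-optimal against $\mathbb{Q}$ if $\mathbb{E}^{\mathbb{Q}_a}[U(\varepsilon^* )] \geq \mathbb{E}^{\mathbb{Q}_a}[U(\varepsilon)]$ for every e-value $\varepsilon$ valid for $\mathcal{G}$ invariance (with $\varepsilon=\infty$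 imposed $\mathbb{Q}_s$-a.s.), whenever both sides are well-defined in $[-\infty,\infty]$; here $\mathbb{E}^{\mathbb{Q}_a}$ denotes integration against the sub-probability $\mathbb{Q}_a$. *)

(* Defs.v *)
(* MathComp-Analysis. *)
From HB Require Import structures.
From mathcomp Require Import all_boot all_order all_algebra.
From mathcomp Require Import all_classical all_reals all_analysis.
From mathcomp Require Import measurable_realfun.

Set Implicit Arguments.
Unset Strict Implicit.
Unset Printing Implicit Defensive.

Import Order.TTheory GRing.Theory Num.Theory.
Import numFieldNormedType.Exports.

Local Open Scope classical_set_scope.
Local Open Scope ring_scope.
Local Open Scope ereal_scope.

HB.mixin Record isTopologicalGroup G & PointedTopological G & Group G := {
  mulg_continuous : continuous (fun p : G * G => (p.1 * p.2)%g) ;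
  invg_continuous : continuous (fun g : G => g^-1%g) }.

#[short(type=topologicalGroupType)]
HB.structure Definition TopologicalGroup :=
  {G of PointedTopological G & Group G & isTopologicalGroup G}.

Record continuous_action (G : topologicalGroupType) (Y : topologicalType) :=
  ContinuousAction {
    act :> G -> Y -> Y ;
    act1g : forall y, act 1%g y = y ;
    actMg : forall g h y, act (g * h)%g y = act g (act h y) ;
    act_continuous : continuous (fun p : G * Y => act p.1 p.2) }.

Notation borel T := (g_sigma_algebraType (@open T)).

Lemma continuous_borel_measurable (S T : ptopologicalType) (f : S -> T) :
  continuous f -> measurable_fun [set: borel S] (f : borel S -> borel T).
Proof.
move=> cf; apply: (@measurability _ _ _ (borel T) _ _ (@open T)) => //.
move=> _ [B oB <-]; rewrite setTI; apply: sub_sigma_algebra.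
by move/continuousP: cf; exact.
Qed.

Section orbits.
Context (G : topologicalGroupType) (Y : ptopologicalType).
Variable a : continuous_action G Y.

Lemma actKg g : cancel (a g) (a g^-1%g).
Proof. by move=> y; rewrite -actMg mulVg act1g. Qed.

Lemma actVKg g : cancel (a g^-1%g) (a g).
Proof. by move=> y; rewrite -actMg mulgV act1g. Qed.

(* The translate g^-1 A of a set A is written a g @^-1` A below. *)
Lemma image_actV g (A : set Y) : a g^-1%g @` A = a g @^-1` A.
Proof.
apply/seteqP; split => [_ [y Ay <-]|y /= Agy]; first by rewrite /= actVKg.
by exists (a g y) => //; rewrite actKg.
Qed.

Definition act_orbit (y : Y) : set Y := [set a g y | g in [set: G]].

Definition same_orbit (y z : Y) : bool := `[< act_orbit y z >].

Lemma same_orbit_is_equiv : equiv_class_of same_orbit.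
Proof.
split=> [y|y z|y x z].
- by apply/asboolP; exists 1%g => //; rewrite act1g.
- by apply/idP/idP => /asboolP[g _ <-]; apply/asboolP;
    exists g^-1%g => //; rewrite actKg.
- move=> /asboolP[g _ <-] /asboolP[h _ <-]; apply/asboolP.
  by exists (h * g)%g => //; rewrite actMg.
Qed.

Lemma same_orbit_sym : symmetric same_orbit.
Proof. by case: same_orbit_is_equiv. Qed.

Canonical same_orbit_equiv := EquivRelPack same_orbit_is_equiv.

(* Y/G, with the quotient topology. *)
Definition orbit_space : Type :=
  quotient_topology {eq_quot same_orbit_equiv}%qT.

HB.instance Definition _ := PointedTopological.on orbit_space.
HB.instance Definition _ := Quotient.on orbit_space.

Definition orbit_set (O : orbit_space) : set Y :=
  [set y | (\pi_orbit_space y)%qT = O].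

Lemma orbit_setE (O : orbit_space) : orbit_set O = act_orbit (repr O).
Proof.
apply/seteqP; split => y; rewrite /orbit_set /=.
  rewrite -[X in _ = X -> _]reprK => /(@eqmodP _ same_orbit_equiv).
  by rewrite [X in is_true X -> _]same_orbit_sym => /asboolP.
move=> Oy; rewrite -[RHS]reprK; apply/(@eqmodP _ same_orbit_equiv).
by rewrite [X in is_true X]same_orbit_sym; apply/asboolP.
Qed.

Definition orbit_map (y : Y) : borel G -> borel Y := fun g => a g y.

Lemma measurable_orbit_map y : measurable_fun [set: borel G] (orbit_map y).
Proof.
apply: continuous_borel_measurable => g.
apply: (@continuous_comp _ _ _ (fun h : G => (h, y))
  (fun p : G * Y => a p.1 p.2)); last exact: act_continuous.
by apply: cvg_pair => //; exact: cvg_cst.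
Qed.

HB.instance Definition _ y :=
  isMeasurableFun.Build _ _ _ _ (orbit_map y) (measurable_orbit_map y).

End orbits.

Section haar.
Context (R : realType) (G : topologicalGroupType).

(* Left invariance is enough: on a second-countable compact Hausdorff group it
   characterizes the Haar probability, which is then also right invariant. *)
Definition is_haar (haar : probability (borel G) R) :=
  forall (g : G) (A : set (borel G)), measurable A ->
    haar ((fun h : G => (g * h)%g) @^-1` A) = haar A.

End haar.

Section evalues.
Context (R : realType) (G : topologicalGroupType) (Y : ptopologicalType).
Variable a : continuous_action G Y.

(* The law of g y for g ~ haar and y a representative of O; by right invariance
   of the Haar measure it does not depend on the representative. *)
Definition unif (haar : probability (borel G) R) (O : orbit_space a) :
    probability (borel Y) R :=
  distribution haar (orbit_map a (repr O)).

Definition group_invariant (P : probability (borel Y) R) :=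
  forall (g : G) (A : set (borel Y)), measurable A -> P (a g @^-1` A) = P A.

Definition evariable (e : borel Y -> \bar R) :=
  measurable_fun [set: borel Y] e /\ forall y, 0 <= e y.

Definition valid_evalue (e : borel Y -> \bar R) := evariable e /\
  forall P : probability (borel Y) R, group_invariant P -> \int[P]_y e y <= 1.

Definition exact_evalue (e : borel Y -> \bar R) := evariable e /\
  forall P : probability (borel Y) R, group_invariant P -> \int[P]_y e y = 1.

Definition group_average (haar : probability (borel G) R)
    (Q : set (borel Y) -> \bar R) : set (borel Y) -> \bar R :=
  fun A => \int[haar]_g Q (a g @^-1` A).

End evalues.

Section lebesgue_decomposition.
Context d (T : measurableType d) (R : realType).
Implicit Types nu mu : set T -> \bar R.

Definition mutually_singular nu mu :=
  exists N, [/\ measurable N, mu N = 0 & nu (~` N) = 0].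

Definition lebesgue_decomposition nu mu (nua nus : {measure set T -> \bar R}) :=
  [/\ forall A, measurable A -> nu A = nua A + nus A,
      nua `<< mu & mutually_singular nus mu].

Definition well_defined_integral (mu : {measure set T -> \bar R})
    (f : T -> \bar R) : bool :=
  (\int[mu]_x f^\+ x) +? (- \int[mu]_x f^\- x).

End lebesgue_decomposition.

Section utility.
Context (R : realType).
Implicit Types U : \bar R -> \bar R.

(* U stands for a function on [0, +oo]: its values at x < 0 are irrelevant. *)
Definition utility U :=
  (forall x y, 0 <= x -> x <= y -> U x <= U y) /\
  U +oo = limf_esup (fun r : R => U r%:E) (pinfty_nbhs R).

(* x |-> c * U x - l * x; at x = +oo this could be +oo - +oo, and the limsup
   of the finite values is used instead. *)
Definition lagrangian U (c : \bar R) (l : R) (x : \bar R) : \bar R :=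
  if x == +oo then
    limf_esup (fun r : R => c * U r%:E - l%:E * r%:E) (pinfty_nbhs R)
  else c * U x - l%:E * x.

Definition argmax (T : Type) (D : set T) (f : T -> \bar R) : set T :=
  [set x | D x /\ forall z, D z -> f z <= f x].

End utility.

Section optimality.
Context (R : realType) (G : topologicalGroupType) (Y : ptopologicalType).
Variable a : continuous_action G Y.

Definition U_optimal (haar : probability (borel G) R) (U : \bar R -> \bar R)
    (Q : probability (borel Y) R) (e : borel Y -> \bar R) :=
  valid_evalue a e /\
  forall Qa Qs : {measure set (borel Y) -> \bar R},
    lebesgue_decomposition Q (group_average a haar Q) Qa Qs ->
    {ae Qs, forall y, e y = +oo} /\
    forall e' : borel Y -> \bar R,
      valid_evalue a e' -> {ae Qs, forall y, e' y = +oo} ->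
      well_defined_integral Qa (U \o e) ->
      well_defined_integral Qa (U \o e') ->
      \int[Qa]_y U (e' y) <= \int[Qa]_y U (e y).

End optimality.

Section mixture.
Context d d' (X : measurableType d) (T : measurableType d') (R : realType).
Variables (mu : probability X R) (Q : R.-pker X ~> T).

Definition mixture (A : set T) : \bar R := \int[mu]_x Q x A.

Let mixture0 : mixture set0 = 0.
Proof. by apply: integral0_eq => x _; rewrite measure0. Qed.

Let mixture_ge0 A : 0 <= mixture A.
Proof. exact: integral_ge0. Qed.

Let mixture_sigma_additive : semi_sigma_additive mixture.
Proof.
move=> F mF tF mUF; rewrite [X in _ --> X](_ : _ =
  \int[mu]_x (\sum_(n <oo) Q x (F n))); last first.
  apply: eq_integral => x _.
  by apply/esym/cvg_lim => //; exact/measure_semi_sigma_additive.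
apply/cvg_closeP; split.
  by apply: is_cvg_nneseries => n _ _; exact: integral_ge0.
rewrite closeE// integral_nneseries// => n.
exact: measurable_kernel.
Qed.

HB.instance Definition _ := isMeasure.Build _ _ _ mixture
  mixture0 mixture_ge0 mixture_sigma_additive.

Let mixture_setT : mixture setT = 1.
Proof.
rewrite /mixture (eq_integral (cst 1)) => [|x _]; last exact: prob_kernel.
by rewrite integral_cst// mul1e; exact: probability_setT.
Qed.

HB.instance Definition _ :=
  Measure_isProbability.Build _ _ _ mixture mixture_setT.

End mixture.

(* Main.v *)
Require Import Defs.
From HB Require Import structures.
From mathcomp Require Import all_boot all_order all_algebra.
From mathcomp Require Import all_classical all_reals all_analysis.
From mathcomp Require Import measurable_realfun lra.

Set Implicit Arguments.
Unset Strict Implicit.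
Unset Printing Implicit Defensive.

Import Order.TTheory GRing.Theory Num.Theory.
Import numFieldNormedType.Exports.

Local Open Scope classical_set_scope.
Local Open Scope ring_scope.
Local Open Scope ereal_scope.
Local Open Scope charge_scope.

(** Exactness and optimality both reduce to the orbits, where everything happens
    under the single law Unif(O).

    Exactness.  The action is jointly measurable because both spaces are second
    countable, so Tonelli applies to (g, y) |-> f (g y): integrating f against the
    group average of P is the same as first averaging f over the orbit of y and
    then integrating over P [orbit_averaging].  An invariant P is its own group
    average, hence the integral of e under P is the P-mean of the orbit averages
    of e, all equal to 1 [exact_evalue_of_unif].  That the average over the orbit
    of y is the integral against Unif of that orbit, whatever representative is
    used, is the right invariance of the Haar probability; it follows from left
    invariance and Tonelli [haar_right_invariant].

    Optimality.  Let Qbar be the group average of the mixture and N a Qbar-null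
    set carrying its singular part, so that the absolutely continuous part is the
    mixture restricted to ~N.  Since Q^O lives on O, Qbar is the mu-mixture of
    the laws Unif(O), so Unif(O)(N) = 0 for mu-almost every O
    [group_average_mixture_null].  For such an O write
    Q^O = Q^O_a + Q^O_s and compare e with a competitor e' outside N:
    under Q^O_a, integrating the pointwise inequality between the Lagrangians
    against Unif(O) gives the comparison, because the multiplier l is charged at
    least as much to e as to e' [argmax_integral_le]; under Q^O_s, e = +oo and the
    comparison is monotonicity of U [decomposition_integral_le].

    Treating the piece of Q^O_s outside N in this way means that the decompositions
    of the Q^O are used one orbit at a time: what is integrated over mu is the
    kernel Q outside the fixed set N, and no decomposition that is measurable in O
    has to be constructed.

    Expected utilities may be infinite or, on some orbits, undefined.  The
    comparison is therefore carried out in the form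
    E[U(e')^+] + E[U(e)^-] <= E[U(e)^+] + E[U(e')^-], which involves nonnegative
    integrals only, is stable under integration over mu, and gives back
    E[U(e')] <= E[U(e)] as soon as both sides are well defined
    [sube_le_of_swap]. *)

(** * Borel measurability and product spaces *)

Lemma countable_bigcup_measurable d (T : measurableType d) (I : Type)
    (D : set I) (F : I -> set T) :
  countable D -> (forall i, D i -> measurable (F i)) ->
  measurable (\bigcup_(i in D) F i).
Proof.
move=> /countable_injP[f injf] mF.
have -> : \bigcup_(i in D) F i =
    \bigcup_n \bigcup_(i in D `&` f @^-1` [set n]) F i.
  apply/seteqP; split => [x [i Di Fix]|x [n _ [i [Di _] Fix]]].
    by exists (f i) => //; exists i.
  by exists i.
apply: bigcup_measurable => n _.
(* f is injective on D, so at most one index of D has code n. *)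
have [[i [Di fi]]|noi] := pselect (exists i, (D `&` f @^-1` [set n]) i).
  rewrite [X in measurable X](_ : _ = F i); first exact: mF.
  apply/seteqP; split => [x [j [Dj fj] Fjx]|x Fix]; last by exists i.
  have -> : i = j by apply: injf; rewrite ?inE// fi fj.
  by [].
by rewrite bigcup0// => i Di; exfalso; apply: noi; exists i.
Qed.

Section product_borel.
Context (S T : ptopologicalType).
Hypotheses (S_sc : @second_countable S) (T_sc : @second_countable T).

(** Second countability makes an open subset of the product a countable union of
    open rectangles, so that the Borel sigma-algebra of the product is contained
    in the product of the Borel sigma-algebras; this is what lets Tonelli's
    theorem apply to functions such as (g, y) |-> f (g y). *)
Lemma open_prod_measurable (A : set (S * T)) :
  open A -> measurable (A : set (borel S * borel T)%type).
Proof.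
move: S_sc T_sc => [B1 cB1 [oB1 nB1]] [B2 cB2 [oB2 nB2]] oA.
pose F (i : set S * set T) : set (borel S * borel T)%type := i.1 `*` i.2.
pose D := [set i | (B1 `*` B2) i /\ F i `<=` A].
have -> : (A : set (borel S * borel T)%type) = \bigcup_(i in D) F i.
  apply/seteqP; split => [[x y] Axy|[x y] [i [_ iA]]]; last exact: iA.
  have [[V W] /= [Vx Wy] VWA] : nbhs (x, y) A by exact: open_nbhs_nbhs.
  have [V' [B1V' V'x] V'V] := nB1 x V Vx.
  have [W' [B2W' W'y] W'W] := nB2 y W Wy.
  exists (V', W') => //; split => // -[u v] [/V'V Vu /W'W Wv].
  exact: VWA.
apply: countable_bigcup_measurable.
  apply: sub_countable (countableX cB1 cB2).
  by apply: subset_card_le => -[u v] [].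
move=> [V W] [[/= BV BW] _]; apply: measurableX; apply: sub_sigma_algebra.
  exact: oB1.
exact: oB2.
Qed.

Lemma continuous2_borel_measurable (Z : ptopologicalType) (f : S * T -> Z) :
  continuous f ->
  measurable_fun setT (f : (borel S * borel T)%type -> borel Z).
Proof.
move=> cf; apply: (@measurability _ _ _ (borel Z) _ _ (@open Z)) => //.
move=> _ [B oB <-]; rewrite setTI; apply: open_prod_measurable.
by move/continuousP: cf; exact.
Qed.

End product_borel.

Lemma continuous_borel_preimage (S T : ptopologicalType) (f : S -> T)
    (A : set (borel T)) :
  continuous f -> measurable A -> measurable (f @^-1` A : set (borel S)).
Proof.
move=> cf mA; rewrite -[X in measurable X]setTI.
exact: continuous_borel_measurable.
Qed.

Lemma integral_probability_cst d (T : measurableType d) (R : realType)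
    (P : probability T R) (c : \bar R) : \int[P]_x cst c x = c.
Proof. by rewrite -[RHS]mule1 -(probability_setT P); exact: integral_cst. Qed.

(** * Right invariance of the Haar probability *)

Section haar_invariance.
Context (R : realType) (G : topologicalGroupType).
Hypothesis G_sc : @second_countable G.
Variable haar : probability (borel G) R.
Hypothesis haarP : is_haar haar.

Let continuous_mulgl (g : G) : continuous (fun h : G => g * h)%g.
Proof.
move=> x; apply: (@continuous_comp _ _ _ (fun h : G => (g, h))
  (fun p : G * G => (p.1 * p.2)%g)); last exact: mulg_continuous.
by apply: cvg_pair => //; exact: cvg_cst.
Qed.

Let continuous_mulgr (g : G) : continuous (fun h : G => h * g)%g.
Proof.
move=> x; apply: (@continuous_comp _ _ _ (fun h : G => (h, g))
  (fun p : G * G => (p.1 * p.2)%g)); last exact: mulg_continuous.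
by apply: cvg_pair => //; exact: cvg_cst.
Qed.

Let measurable_divgl : measurable_fun setT
  ((fun p : G * G => (p.1^-1 * p.2)%g) : (borel G * borel G)%type -> borel G).
Proof.
apply: continuous2_borel_measurable => // p.
apply: (@continuous_comp _ _ _ (fun p : G * G => (p.1^-1%g, p.2))
  (fun p : G * G => (p.1 * p.2)%g)); last exact: mulg_continuous.
apply: cvg_pair; last exact: cvg_snd.
apply: (@continuous_comp _ _ _ fst (fun g : G => g^-1%g)).
  exact: cvg_fst.
exact: invg_continuous.
Qed.

(** Integrate the indicator of g^-1 h \in A over g and h independent: for fixed g,
    left invariance in h gives the measure of A; for fixed h, the condition reads
    (h^-1 g)^-1 \in A and left invariance in g gives the measure of A^-1. *)
Lemma haar_invg (A : set (borel G)) : measurable A ->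
  haar ((fun g : G => g^-1%g) @^-1` A) = haar A.
Proof.
move=> mA.
have mV := continuous_borel_preimage (@invg_continuous G) mA.
pose f : (borel G * borel G)%type -> \bar R :=
  fun p => (\1_A ((p.1 : G)^-1 * p.2 : G)%g)%:E.
have mf : measurable_fun setT f.
  by apply/measurable_EFinP; apply: measurableT_comp measurable_divgl.
have f0 p : 0 <= f p by rewrite lee_fin.
have := fubini_tonelli (m1 := haar) (m2 := haar) f mf f0.
rewrite (eq_integral (cst (haar A))); last first.
  move=> g _.
  transitivity (\int[haar]_h (\1_((fun h : G => (g^-1 * h)%g) @^-1` A) h)%:E).
    by apply: eq_integral => h _; rewrite /f !indicE.
  rewrite integral_indic// ?setIT; first exact: haarP.
  exact: continuous_borel_preimage.
rewrite [X in _ = X -> _](eq_integral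
    (cst (haar ((fun g : G => g^-1%g) @^-1` A)))); last first.
  move=> h _.
  transitivity (\int[haar]_g (\1_((fun g : G => (h^-1 * g)%g) @^-1`
      ((fun g : G => g^-1%g) @^-1` A)) g)%:E).
    apply: eq_integral => g _; rewrite /f !indicE /=.
    suff -> : ((g : G)^-1 * h = ((h : G)^-1 * g)^-1)%g by [].
    by rewrite invgM invgK.
  rewrite integral_indic// ?setIT; first exact: haarP.
  exact: continuous_borel_preimage.
by rewrite !integral_probability_cst.
Qed.

(** Right translation is left translation conjugated by inversion. *)
Lemma haar_right_invariant g (A : set (borel G)) : measurable A ->
  haar ((fun h : G => (h * g)%g) @^-1` A) = haar A.
Proof.
move=> mA; have mV := continuous_borel_preimage (@invg_continuous G) mA.
rewrite -[RHS]haar_invg// -[RHS](@haarP g^-1%g _ mV).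
rewrite -haar_invg; last exact: continuous_borel_preimage.
by congr (haar _); apply/funext => h /=; rewrite /preimage /= invgM invgK.
Qed.

End haar_invariance.

(** * Averages over orbits *)

Section orbit_averages.
Context (R : realType) (G : topologicalGroupType) (Y : ptopologicalType).
Hypotheses (G_sc : @second_countable G) (Y_sc : @second_countable Y).
Variables (a : continuous_action G Y) (haar : probability (borel G) R).
Hypothesis haarP : is_haar haar.

Local Notation pi := (fun y : Y => (\pi_(orbit_space a) y)%qT).

Lemma act_measurable g :
  measurable_fun setT (a g : borel Y -> borel Y).
Proof.
apply: continuous_borel_measurable => y.
apply: (@continuous_comp _ _ _ (fun z : Y => (g, z))
  (fun p : G * Y => a p.1 p.2)); last exact: act_continuous.
by apply: cvg_pair => //; exact: cvg_cst.
Qed.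

Lemma act_preimage_measurable g (A : set (borel Y)) :
  measurable A -> measurable (a g @^-1` A : set (borel Y)).
Proof.
by move=> mA; rewrite -[X in measurable X]setTI; exact: act_measurable.
Qed.

Lemma act2_measurable : measurable_fun setT
  ((fun p : G * Y => a p.1 p.2) : (borel G * borel Y)%type -> borel Y).
Proof.
by apply: continuous2_borel_measurable => //; exact: act_continuous.
Qed.

Lemma orbit_map_preimage_measurable y (A : set (borel Y)) :
  measurable A -> measurable (orbit_map a y @^-1` A).
Proof.
by move=> mA; rewrite -[X in measurable X]setTI; exact: measurable_orbit_map.
Qed.

(** If y = k (repr O), the map h |-> h y is the orbit map of repr O precomposed
    with the right translation by k; the choice of representative is therefore
    immaterial by right invariance. *)
Lemma unifE y (A : set (borel Y)) : measurable A ->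
  unif haar (pi y) A = haar (orbit_map a y @^-1` A).
Proof.
move=> mA; have : orbit_set (pi y) y by [].
rewrite orbit_setE => -[k _ ky]; rewrite /unif /distribution /pushforward /=.
rewrite -[LHS](haar_right_invariant G_sc haarP k); last first.
  exact: orbit_map_preimage_measurable.
by congr (haar _); apply/funext => h; rewrite /preimage /= /orbit_map actMg ky.
Qed.

Lemma ge0_integral_unif y (f : borel Y -> \bar R) :
  measurable_fun setT f -> (forall z, 0 <= f z) ->
  \int[unif haar (pi y)]_z f z = \int[haar]_g f (a g y).
Proof.
move=> mf f0.
rewrite -[RHS](ge0_integral_distribution (P := haar) (orbit_map a y) mf f0).
by apply: eq_measure_integral => A mA _; exact: unifE.
Qed.

Lemma unif_invariant (O : orbit_space a) : group_invariant a (unif haar O).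
Proof.
move=> g A mA; rewrite /unif /distribution /pushforward /=.
rewrite -[RHS](haarP g); last exact: orbit_map_preimage_measurable.
by congr (haar _); apply/funext => h; rewrite /preimage /= /orbit_map actMg.
Qed.

Lemma ge0_integral_act (P : probability (borel Y) R) g (f : borel Y -> \bar R) :
  group_invariant a P -> measurable_fun setT f -> (forall z, 0 <= f z) ->
  \int[P]_y f (a g y) = \int[P]_y f y.
Proof.
move=> Pinv mf f0.
transitivity (\int[pushforward P (a g : borel Y -> borel Y)]_y f y).
  by rewrite (ge0_integral_pushforward (act_measurable g)).
apply: eq_measure_integral => [|ag A mA _]; first exact: act_measurable.
exact: Pinv.
Qed.

(** Tonelli's theorem for (g, y) |-> f (g y): the left-hand side is the integral
    of f against the group average of P. *)
Lemma orbit_averaging (P : probability (borel Y) R) (f : borel Y -> \bar R) :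
  measurable_fun setT f -> (forall z, 0 <= f z) ->
  \int[haar]_g \int[P]_y f (a g y) = \int[P]_y \int[unif haar (pi y)]_z f z.
Proof.
move=> mf f0.
have mF : measurable_fun setT
    (fun p : (borel G * borel Y)%type => f (a p.1 p.2)).
  exact: measurableT_comp mf act2_measurable.
rewrite (fubini_tonelli _ mF (fun=> f0 _)).
by apply: eq_integral => y _; rewrite ge0_integral_unif.
Qed.

Lemma measurable_integral_unif (f : borel Y -> \bar R) :
  measurable_fun setT f -> (forall z, 0 <= f z) ->
  measurable_fun [set: borel Y] (fun y => \int[unif haar (pi y)]_z f z).
Proof.
move=> mf f0.
have mF : measurable_fun setT
    (fun p : (borel G * borel Y)%type => f (a p.1 p.2)).
  exact: measurableT_comp mf act2_measurable.
have := measurable_fun_fubini_tonelli_G (m1 := haar) _ mF (fun=> f0 _).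
apply: eq_measurable_fun => y _.
by rewrite ge0_integral_unif.
Qed.

Lemma invariant_integral (P : probability (borel Y) R) (f : borel Y -> \bar R) :
  group_invariant a P -> measurable_fun setT f -> (forall z, 0 <= f z) ->
  \int[P]_y f y = \int[P]_y \int[unif haar (pi y)]_z f z.
Proof.
move=> Pinv mf f0; rewrite -orbit_averaging//.
rewrite [RHS](eq_integral (cst (\int[P]_y f y))) => [|g _].
  by rewrite integral_probability_cst.
exact: ge0_integral_act.
Qed.

Lemma group_averageE (P : probability (borel Y) R) (A : set (borel Y)) :
  measurable A ->
  group_average a haar P A = \int[P]_y unif haar (pi y) A.
Proof.
move=> mA; rewrite /group_average.
transitivity (\int[haar]_g \int[P]_y (\1_A (a g y))%:E).
  apply: eq_integral => g _.
  rewrite -[RHS]/(\int[P]_y (\1_(a g @^-1` A : set (borel Y)) y)%:E).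
  rewrite integral_indic ?setIT//; exact: act_preimage_measurable.
rewrite (orbit_averaging P (f := fun y => (\1_A y)%:E))//; last first.
  exact/measurable_EFinP/measurable_indic.
by apply: eq_integral => y _; rewrite integral_indic// setIT.
Qed.

Lemma exact_evalue_of_unif (e : borel Y -> \bar R) :
  measurable_fun setT e -> (forall z, 0 <= e z) ->
  (forall O : orbit_space a, \int[unif haar O]_y e y = 1) -> exact_evalue a e.
Proof.
move=> me e0 e1; split=> // P Pinv; rewrite invariant_integral//.
rewrite (eq_integral (cst 1)) => [|y _]; last exact: e1.
by rewrite integral_probability_cst.
Qed.

(** Orbits are closed, as images of a compact group. *)
Lemma orbit_set_measurable (O : orbit_space a) :
  compact [set: G] -> hausdorff_space Y ->
  measurable (orbit_set O : set (borel Y)).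
Proof.
move=> cG hY; rewrite orbit_setE -[X in measurable X]setCK.
apply: measurableC; apply: sub_sigma_algebra.
apply: closed_openC; apply: compact_closed => //.
apply: continuous_compact => //; apply: continuous_subspaceT => g.
apply: (@continuous_comp _ _ _ (fun h : G => (h, repr O))
  (fun p : G * Y => a p.1 p.2)); last exact: act_continuous.
by apply: cvg_pair => //; exact: cvg_cst.
Qed.

End orbit_averages.

(** * Monotone utilities and mixtures *)

(** The preimage of a ray is an upper set, that is, a ray starting at its infimum,
    which is closed or open according to whether the infimum belongs to it. *)
Lemma nondecreasing_emeasurable (R : realType) (f : \bar R -> \bar R) :
  {homo f : x y / x <= y} -> measurable_fun setT f.
Proof.
move=> f_nd; apply: (measurability _ (ErealGenCInfty.measurableE R)) => //.
move=> _ [_ [r ->] <-]; rewrite setTI; set S := _ @^-1` _.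
have upS x y : S x -> x <= y -> S y.
  by rewrite /S /= !in_itv/= !andbT => rx /f_nd; exact: le_trans.
have [Sinf|nSinf] := pselect (S (ereal_inf S)).
- rewrite (_ : S = `[ereal_inf S, +oo[%classic); first exact: emeasurable_itv.
  apply/seteqP; split=> x /=; rewrite in_itv/= andbT.
    exact: ereal_inf_lbound.
  exact: upS.
- rewrite (_ : S = `]ereal_inf S, +oo[%classic); first exact: emeasurable_itv.
  apply/seteqP; split=> x /=; rewrite in_itv/= andbT.
    move=> Sx; rewrite lt_neqAle ereal_inf_lbound// andbT.
    by apply/eqP => infx; apply: nSinf; rewrite infx.
  by move=> /ereal_inf_lt[y Sy /ltW]; exact: upS.
Qed.

Lemma utility_measurable d (T : measurableType d) (R : realType)
    (U : \bar R -> \bar R) (e : T -> \bar R) :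
  utility U -> measurable_fun setT e -> (forall y, 0 <= e y) ->
  measurable_fun setT (U \o e).
Proof.
move=> [U_nd _] me e0.
(* U need not be monotone below 0, so it is precomposed with maxe _ 0. *)
have mV : measurable_fun setT (fun x : \bar R => U (maxe x 0)).
  apply: nondecreasing_emeasurable => x y xy; apply: U_nd.
    by rewrite le_max lexx orbT.
  by rewrite ge_max !le_max lexx xy orbT.
apply: eq_measurable_fun (measurableT_comp mV me) => y _ /=.
by rewrite max_l.
Qed.

Section mixture_integral.
Context d d' (X : measurableType d) (T : measurableType d') (R : realType).
Variables (mu : probability X R) (Q : R.-pker X ~> T).

(** A mixture is the composition of the constant kernel mu with Q. *)
Lemma ge0_integral_mixture (f : T -> \bar R) :
  measurable_fun setT f -> (forall t, 0 <= f t) ->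
  \int[mixture mu Q]_t f t = \int[mu]_x \int[Q x]_t f t.
Proof.
move=> mf f0.
have mmu : measurable_fun [set: unit]
    (cst (mu : pprobability X R) : unit -> pprobability X R).
  exact: measurable_cst.
by rewrite -(@integral_kcomp _ _ _ unit X T R (kprobability mmu)
  (kernel.kernel_snd Q) tt)//.
Qed.

Lemma measurable_integral_pker (f : T -> \bar R) :
  measurable_fun setT f -> (forall t, 0 <= f t) ->
  measurable_fun [set: X] (fun x => \int[Q x]_t f t).
Proof.
move=> mf f0; apply: measurable_fun_integral_kernel => // A mA.
exact: measurable_kernel.
Qed.

End mixture_integral.

(** * The Lagrangian comparison under one law *)

(** U is split into its positive and negative parts and every subtracted term
    moves to the other side: no difference of infinities is left, so that the
    inequality can be integrated term by term. *)
Lemma lagrangian_le (R : realType) (U : \bar R -> \bar R) (c l x x' : R) :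
  (0 <= c)%R -> lagrangian U c%:E l x'%:E <= lagrangian U c%:E l x%:E ->
  U^\+ x'%:E * c%:E + U^\- x%:E * c%:E + l%:E * x%:E <=
  U^\+ x%:E * c%:E + U^\- x'%:E * c%:E + l%:E * x'%:E.
Proof.
rewrite /lagrangian/= le_eqVlt => /predU1P[<-|c0].
  by rewrite !mul0e !mule0 !add0e !lee_fin lerN2.
rewrite !funeposE !funenegE -!EFinM.
have maxyE : maxe +oo 0 = +oo :> \bar R by rewrite max_l// leey.
have maxNyE : maxe -oo 0 = 0 :> \bar R by rewrite max_r// leNye.
have maxE (r : R) : maxe r%:E 0 = (Num.max r 0)%:E by rewrite EFin_max.
case: (U x%:E) => [u| |]; case: (U x'%:E) => [u'| |];
  rewrite /= ?(gt0_muley, gt0_muleNy) ?lte_fin//= ?maxyE ?maxNyE ?maxE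
    ?gt0_mulye ?lte_fin// ?mul0e ?add0e ?adde0 -?EFinM -?EFinD
    ?addye ?addey ?leey//.
have maxB (r : R) : r = (Num.max r 0 - Num.max (- r) 0)%R.
  by case: (leP r 0%R); case: (leP (- r)%R 0%R); lra.
rewrite !lee_fin {1}(maxB u) {1}(maxB u'); lra.
Qed.

(** Integrate lagrangian_le against P, with c the density of nu.  Both e and e'
    are P-a.s. finite since their integrals are at most 1, as lagrangian_le
    requires; and l E[e] = l >= l E[e'] lets the multiplier terms cancel. *)
Lemma argmax_integral_le d (T : measurableType d) (R : realType)
    (P : probability T R) (nu : {finite_measure set T -> \bar R})
    (U : \bar R -> \bar R) (l : R) (e e' : T -> \bar R) :
  nu `<< P -> utility U -> (0 <= l)%R ->
  measurable_fun setT e -> (forall y, 0 <= e y) ->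
  measurable_fun setT e' -> (forall y, 0 <= e' y) ->
  \int[P]_y e y = 1 -> \int[P]_y e' y <= 1 ->
  {ae P, forall y, argmax [set x | 0 <= x]
    (lagrangian U (('d (charge_of_finite_measure nu) '/d P) y) l) (e y)} ->
  \int[nu]_y (U \o e')^\+ y + \int[nu]_y (U \o e)^\- y <=
  \int[nu]_y (U \o e)^\+ y + \int[nu]_y (U \o e')^\- y.
Proof.
move=> nuP HU l0 me e0 me' e'0 e1 e'1 emax.
have mUe := utility_measurable HU me e0.
have mUe' := utility_measurable HU me' e'0.
(* A version of the density of nu that is nonnegative and finite everywhere. *)
pose q := Radon_Nikodym_SigmaFinite.f nu P.
have q0 y : 0 <= q y by exact: Radon_Nikodym_SigmaFinite.f_ge0.
have mq : measurable_fun setT q.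
  exact: measurable_int (Radon_Nikodym_SigmaFinite.f_integrable nuP).
have int_nu (f : T -> \bar R) : (forall y, 0 <= f y) -> measurable_fun setT f ->
    \int[nu]_y f y = \int[P]_y (f y * q y).
  by move=> f0 mf; rewrite Radon_Nikodym_SigmaFinite.change_of_variables.
have le1_fin (f : T -> \bar R) : measurable_fun setT f -> (forall y, 0 <= f y) ->
    \int[P]_y f y <= 1 -> {ae P, forall y, f y \is a fin_num}.
  move=> mf f0 f1; have intf : P.-integrable setT f.
    apply/integrableP; split=> //; under eq_integral do rewrite gee0_abs//.
    by rewrite (le_lt_trans f1)// ltry.
  by apply: filterS (integrable_ae measurableT intf) => y; exact.
have q_fin y : q y \is a fin_num by exact: Radon_Nikodym_SigmaFinite.f_fin_num.
have eq_q : ae_eq P setT q ('d (charge_of_finite_measure nu) '/d P).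
  exact: ae_eq_Radon_Nikodym_SigmaFinite.
clearbody q.
have mS (f g h : T -> \bar R) : measurable_fun setT f -> measurable_fun setT g ->
    measurable_fun setT h ->
    measurable_fun setT (fun y => f y * q y + g y * q y + l%:E * h y).
  move=> mf mg mh; apply: emeasurable_funD; last exact: measurable_funeM.
  by apply: emeasurable_funD; exact: emeasurable_funM.
have S0 (f g h : T -> \bar R) : (forall y, 0 <= f y) -> (forall y, 0 <= g y) ->
    (forall y, 0 <= h y) -> forall y, 0 <= f y * q y + g y * q y + l%:E * h y.
  move=> f0 g0 h0 y; apply: adde_ge0; last exact: mule_ge0.
  by apply: adde_ge0; exact: mule_ge0.
have intS (f g h : T -> \bar R) : (forall y, 0 <= f y) -> (forall y, 0 <= g y) ->
    (forall y, 0 <= h y) -> measurable_fun setT f -> measurable_fun setT g ->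
    measurable_fun setT h ->
    \int[P]_y (f y * q y + g y * q y + l%:E * h y) =
    \int[nu]_y f y + \int[nu]_y g y + l%:E * \int[P]_y h y.
  move=> f0 g0 h0 mf mg mh; rewrite !int_nu//.
  have fq0 y : setT y -> 0 <= f y * q y by move=> _; exact: mule_ge0.
  have gq0 y : setT y -> 0 <= g y * q y by move=> _; exact: mule_ge0.
  have mfq : measurable_fun setT (fun y => f y * q y) by exact: emeasurable_funM.
  have mgq : measurable_fun setT (fun y => g y * q y) by exact: emeasurable_funM.
  have lh0 y : setT y -> 0 <= l%:E * h y by move=> _; exact: mule_ge0.
  rewrite ge0_integralD//; last 3 first.
  - by move=> y _; apply: adde_ge0; [exact: fq0|exact: gq0].
  - exact: emeasurable_funD.
  - exact: measurable_funeM.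
  by rewrite ge0_integralD// ge0_integralZl.
have key :
    \int[P]_y ((U \o e')^\+ y * q y + (U \o e)^\- y * q y + l%:E * e y) <=
    \int[P]_y ((U \o e)^\+ y * q y + (U \o e')^\- y * q y + l%:E * e' y).
  have e_fin : {ae P, forall y, e y \is a fin_num} by apply: le1_fin; rewrite ?e1.
  have e'_fin := le1_fin _ me' e'0 e'1.
  apply: ae_ge0_le_integral => //.
  - by move=> y _; apply: S0.
  - by apply: mS => //; [exact: measurable_funepos|exact: measurable_funeneg].
  - by move=> y _; apply: S0.
  - by apply: mS => //; [exact: measurable_funepos|exact: measurable_funeneg].
  apply: filterS2 (filterI emax eq_q) (filterI e_fin e'_fin).
  move=> y [[_ ymax] qE] [ey e'y] _; move: (ymax _ (e'0 y)).
  rewrite -qE//.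
  have -> : (U \o e')^\+ y = U^\+ (e' y) by rewrite funepos_comp.
  have -> : (U \o e)^\+ y = U^\+ (e y) by rewrite funepos_comp.
  have -> : (U \o e')^\- y = U^\- (e' y) by rewrite funeneg_comp.
  have -> : (U \o e)^\- y = U^\- (e y) by rewrite funeneg_comp.
  rewrite -(fineK (q_fin y)) -(fineK ey) -(fineK e'y).
  by apply: lagrangian_le; exact: fine_ge0.
move: key; rewrite (intS _ _ _ _ _ e0) ?(intS _ _ _ _ _ e'0)//;
  do ?[exact: measurable_funepos|exact: measurable_funeneg].
rewrite e1 mule1 => key; rewrite -(leeD2rE (x := l%:E))//.
apply: (le_trans key); apply: leeD2l.
by rewrite -[leRHS]mule1 lee_wpmul2l.
Qed.

(** With p - n and p' - n' the expectations of U(e) and U(e'), it recovers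
    the inequality between expectations from the comparison of nonnegative
    integrals. *)
Lemma sube_le_of_swap (R : realType) (p n p' n' : \bar R) :
  0 <= p -> 0 <= n -> 0 <= p' -> 0 <= n' ->
  p' +? - n' -> p +? - n -> p' + n <= p + n' -> p' - n' <= p - n.
Proof.
move: p n p' n' => [p| |] [n| |] [p'| |] [n'| |]//=; rewrite ?leey ?leNye//.
rewrite -!EFinD !lee_fin => *; lra.
Qed.

(** * Lebesgue decompositions off a null set *)

Section restricted_decomposition.
Context d (T : measurableType d) (R : realType).

(** Outside a null set N of nua nothing of nua is lost, whereas part of nus may
    remain there. *)
Lemma ge0_integral_dec_setC (nu nua nus : {measure set T -> \bar R})
    (N : set T) (f : T -> \bar R) :
  (forall A, measurable A -> nu A = nua A + nus A) ->
  measurable N -> nua N = 0 ->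
  measurable_fun setT f -> (forall y, 0 <= f y) ->
  \int[nu]_(y in ~` N) f y = \int[nua]_y f y + \int[nus]_(y in ~` N) f y.
Proof.
move=> nuE mN nuaN mf f0.
rewrite (ge0_negligible_integral mN measurableT mf _ nuaN)// setTD.
have mCN := measurableC mN.
rewrite -ge0_integral_measure_add//; last exact: measurable_funTS.
apply: eq_measure_integral => A mA _.
by rewrite nuE//; exact/esym/measure_addE.
Qed.

(** When N moreover carries nus, the part nua is the restriction of nu to the
    complement of N. *)
Lemma ge0_integral_dec_null (nu nua nus : {measure set T -> \bar R})
    (N : set T) (f : T -> \bar R) :
  (forall A, measurable A -> nu A = nua A + nus A) ->
  measurable N -> nua N = 0 -> nus (~` N) = 0 ->
  measurable_fun setT f -> (forall y, 0 <= f y) ->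
  \int[nua]_y f y = \int[nu]_(y in ~` N) f y.
Proof.
move=> nuE mN nuaN nusN mf f0.
rewrite (ge0_integral_dec_setC nuE mN nuaN)//.
rewrite [X in _ + X](_ : _ = 0) ?adde0//.
rewrite (ge0_negligible_integral (measurableC mN) (measurableC mN) _ _ nusN)//.
  by rewrite setDv integral_set0.
exact: measurable_funTS.
Qed.

End restricted_decomposition.

(** Off N, nu is nua plus a piece of nus.  The first part is covered by
    argmax_integral_le; on the second e = +oo maximizes U. *)
Lemma decomposition_integral_le d (T : measurableType d) (R : realType)
    (P : probability T R) (nu : {measure set T -> \bar R})
    (nua nus : {finite_measure set T -> \bar R}) (N : set T)
    (U : \bar R -> \bar R) (l : R) (e e' : T -> \bar R) :
  lebesgue_decomposition nu P nua nus -> measurable N -> P N = 0 ->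
  utility U -> (0 <= l)%R ->
  measurable_fun setT e -> (forall y, 0 <= e y) ->
  measurable_fun setT e' -> (forall y, 0 <= e' y) ->
  \int[P]_y e y = 1 -> \int[P]_y e' y <= 1 ->
  {ae P, forall y, argmax [set x | 0 <= x]
    (lagrangian U (('d (charge_of_finite_measure nua) '/d P) y) l) (e y)} ->
  {ae nus, forall y, e y = +oo} ->
  \int[nu]_(y in ~` N) (U \o e')^\+ y + \int[nu]_(y in ~` N) (U \o e)^\- y <=
  \int[nu]_(y in ~` N) (U \o e)^\+ y + \int[nu]_(y in ~` N) (U \o e')^\- y.
Proof.
move=> [nuE nuaP _] mN PN HU l0 me e0 me' e'0 e1 e'1 emax einf.
have mUe := utility_measurable HU me e0.
have mUe' := utility_measurable HU me' e'0.
have mCN := measurableC mN.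
have nuaN : nua N = 0 by move/null_content_dominatesP: nuaP => /(_ N mN PN).
rewrite !(ge0_integral_dec_setC nuE mN nuaN)//;
  do ?[exact: measurable_funepos|exact: measurable_funeneg].
rewrite addeACA [leRHS]addeACA; apply: leeD.
  exact: argmax_integral_le emax.
have Ule y : e y = +oo -> U (e' y) <= U (e y).
  by move=> ->; apply: HU.1; rewrite ?leey.
apply: leeD; apply: ae_ge0_le_integral => //;
  do ?[exact/measurable_funTS/measurable_funepos
      |exact/measurable_funTS/measurable_funeneg];
  move: einf; apply: filterS => y /Ule Uy _.
  by rewrite !funeposE /= ge_max !le_max Uy lexx orbT.
by rewrite !funenegE /= ge_max !le_max leeN2 Uy lexx orbT.
Qed.

(** * Mixtures of laws concentrated on the orbits *)

Section mixtures_over_orbits.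
Context (R : realType) (G : topologicalGroupType) (Y : ptopologicalType).
Hypotheses (G_sc : @second_countable G) (Y_sc : @second_countable Y).
Hypotheses (G_compact : compact [set: G]) (Y_haus : hausdorff_space Y).
Variables (a : continuous_action G Y) (haar : probability (borel G) R).
Hypothesis haarP : is_haar haar.
Variable Q : R.-pker (borel (orbit_space a)) ~> (borel Y).
Hypothesis Q_conc : forall O : orbit_space a, Q O (orbit_set O) = 1.
Variable mu : probability (borel (orbit_space a)) R.

(** A function of the orbit of y is Q^O-a.s. constant, as Q^O lives on O. *)
Lemma integral_on_orbit (O : orbit_space a) (h : orbit_space a -> \bar R) :
  measurable_fun setT (fun y : borel Y => h (\pi_(orbit_space a) y)%qT) ->
  \int[Q O]_y h (\pi_(orbit_space a) y)%qT = h O.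
Proof.
move=> mh; have mO := orbit_set_measurable O G_compact Y_haus.
rewrite (ae_eq_integral (cst (h O)))//.
  rewrite integral_cst//.
  have -> : Q O setT = 1 by exact: prob_kernel.
  by rewrite mule1.
exists (~` orbit_set O); split; first exact: measurableC.
- have QT : Q O setT = 1 by exact: prob_kernel.
  have fin : Q O (orbit_set O) \is a fin_num by rewrite Q_conc.
  rewrite -setTD measureD ?setTI//=; last by rewrite ltey_eq QT.
  by rewrite QT Q_conc subee.
- by move=> y /= hy Oy; apply: hy => _; rewrite Oy.
Qed.

Let measurable_unif_pi (A : set (borel Y)) : measurable A ->
  measurable_fun [set: borel Y]
    (fun y => unif haar (\pi_(orbit_space a) y)%qT A).
Proof.
move=> mA.
have mI : measurable_fun setT (fun y : borel Y => (\1_A y)%:E : \bar R).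
  exact/measurable_EFinP/measurable_indic.
have I0 (y : borel Y) : 0 <= (\1_A y)%:E :> \bar R by rewrite lee_fin.
apply: eq_measurable_fun (measurable_integral_unif G_sc Y_sc a haarP mI I0).
by move=> y _; rewrite integral_indic// setIT.
Qed.

(** O |-> Unif(O)(A) is the integral of y |-> Unif(orbit of y)(A) against the
    kernel Q, and in the latter function representatives have been eliminated by
    unifE. *)
Lemma measurable_unif (A : set (borel Y)) : measurable A ->
  measurable_fun [set: borel (orbit_space a)] (fun O => unif haar O A).
Proof.
move=> mA; have mh := measurable_unif_pi mA.
have h0 y : 0 <= unif haar (\pi_(orbit_space a) y)%qT A by exact: measure_ge0.
apply: eq_measurable_fun (measurable_integral_pker Q mh h0) => O _.
exact: (@integral_on_orbit O (fun O => unif haar O A) mh).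
Qed.

Lemma group_average_mixture (A : set (borel Y)) : measurable A ->
  group_average a haar (mixture mu Q) A = \int[mu]_O unif haar O A.
Proof.
move=> mA; have mh := measurable_unif_pi mA.
rewrite (group_averageE G_sc Y_sc a haarP)// ge0_integral_mixture//.
apply: eq_integral => O _.
exact: (@integral_on_orbit O (fun O => unif haar O A) mh).
Qed.

Lemma group_average_mixture_null (N : set (borel Y)) : measurable N ->
  group_average a haar (mixture mu Q) N = 0 ->
  {ae mu, forall O : orbit_space a, unif haar O N = 0}.
Proof.
move=> mN; rewrite group_average_mixture// => N0.
have mN' := measurable_unif mN.
have [+ _] := ae_eq_integral_abs mu measurableT mN'.
under eq_integral do rewrite gee0_abs//.
by move=> /(_ N0); apply: filterS => O; exact.
Qed.

(** The group average enters the domination hypothesis as a mere set function;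
    the monotonicity that is required comes from group_average_mixture. *)
Lemma dominated_by_group_average (nu : set (borel Y) -> \bar R)
    (N : set (borel Y)) :
  nu `<< group_average a haar (mixture mu Q) -> measurable N ->
  group_average a haar (mixture mu Q) N = 0 -> nu N = 0.
Proof.
move=> nuQ mN N0; apply: (nuQ N) => // A mA AN.
rewrite group_average_mixture//.
rewrite (ae_eq_integral (cst 0)) ?integral0//; first exact: measurable_unif.
have [M [mM M0 NM]] := group_average_mixture_null mN N0.
exists M; split=> // O /= OA; apply: NM => /= ON.
by apply: OA => _; exact: subset_measure0 AN ON.
Qed.

End mixtures_over_orbits.

(** * The theorem *)

Theorem corollary5 (R : realType)
    (G : topologicalGroupType) (Y : ptopologicalType)
    (G_sc : @second_countable G) (G_haus : hausdorff_space G)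
    (G_compact : compact [set: G])
    (Y_sc : @second_countable Y) (Y_haus : hausdorff_space Y)
    (Y_lc : locally_compact [set: Y])
    (a : continuous_action G Y)
    (haar : probability (borel G) R) (haarP : is_haar haar)
    (Q : R.-pker (borel (orbit_space a)) ~> (borel Y))
    (Q_conc : forall O : orbit_space a, Q O (orbit_set O) = 1)
    (Qa Qs : orbit_space a -> {finite_measure set (borel Y) -> \bar R})
    (Q_dec : forall O : orbit_space a,
      lebesgue_decomposition (Q O) (unif haar O) (Qa O) (Qs O))
    (U : \bar R -> \bar R) (U_utility : utility U)
    (e : borel Y -> \bar R) (e_meas : measurable_fun [set: borel Y] e)
    (e_ge0 : forall y, 0 <= e y)
    (e_unif : forall O : orbit_space a, \int[unif haar O]_y e y = 1)
    (e_argmax : forall O : orbit_space a, exists l : R, (0 <= l)%R /\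
      {ae unif haar O, forall y,
        argmax [set x | 0 <= x]
          (lagrangian U
            (('d (charge_of_finite_measure (Qa O)) '/d (unif haar O)) y) l)
          (e y)})
    (e_sing : forall O : orbit_space a, {ae Qs O, forall y, e y = +oo}) :
  exact_evalue a e /\
  forall mu : probability (borel (orbit_space a)) R,
    U_optimal a haar U (mixture mu Q) e.
Proof.
have e_exact := exact_evalue_of_unif G_sc Y_sc haarP e_meas e_ge0 e_unif.
split=> // mu; split.
  by case: e_exact => ev e1; split=> // P /e1 ->.
move=> QMa QMs [QME QMa_dom [N [mN N0 QMsN]]].
have mCN := measurableC mN.
have QMaN : QMa N = 0.
  exact: (dominated_by_group_average G_sc Y_sc G_compact Y_haus haarP Q_conc
    QMa_dom).
have unifN : {ae mu, forall O : orbit_space a, unif haar O N = 0}.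
  exact: (group_average_mixture_null G_sc Y_sc G_compact Y_haus haarP Q_conc mN
    N0).
have int_QMa (f : borel Y -> \bar R) : measurable_fun setT f ->
    (forall y, 0 <= f y) ->
    \int[QMa]_y f y = \int[mu]_O \int[Q O]_(y in ~` N) f y.
  move=> mf f0; rewrite (ge0_integral_dec_null QME mN QMaN QMsN)//.
  rewrite integral_mkcond ge0_integral_mixture//.
  - by apply: eq_integral => O _; rewrite -integral_mkcond.
  - exact: (measurable_restrictT f mCN).1 (measurable_funTS mf).
  - by move=> y; rewrite patchE; case: ifP.
split.
  (* The part of {e < +oo} inside N is charged neither by Q^O_s, by hypothesis,
     nor by Q^O_a << Unif(O), for almost every O. *)
  pose F : set (borel Y) := [set y | e y != +oo].
  have mF : measurable F.
    have -> : F = ~` (e @^-1` [set +oo]).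
      by apply/seteqP; split=> y /= /eqP.
    by apply: measurableC; rewrite -[X in measurable X]setTI; exact: e_meas.
  suff QMsF0 : QMs F = 0 by exists F; split=> // y /= /eqP.
  have QMsF : QMs F = QMs (F `&` N).
    have mFD : measurable (F `\` N) by exact: measurableD.
    have FDN : F `\` N `<=` ~` N by move=> y [].
    have FD0 : QMs (F `\` N) = 0 by exact: (subset_measure0 mFD mCN FDN QMsN).
    transitivity (QMs (F `\` N) + QMs (F `&` N)); first exact: measureDI.
    by rewrite FD0 add0e.
  have mFN : measurable (F `&` N) by exact: measurableI.
  have QMaFN : QMa (F `&` N) = 0 by exact: (subset_measure0 mFN mN _ QMaN).
  have : mixture mu Q (F `&` N) = QMs (F `&` N) by rewrite QME// QMaFN add0e.
  rewrite QMsF => <-; rewrite /mixture.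
  rewrite (ae_eq_integral (cst 0)) ?integral0//; first exact: measurable_kernel.
  have [M [mM M0 NM]] := unifN.
  exists M; split=> // O /= QO; apply: NM => /= ON; apply: QO => _.
  have [QE Qa_dom _] := Q_dec O.
  rewrite QE// [X in X + _](_ : _ = 0) ?add0e; last first.
    apply: subset_measure0 (_ : Qa O N = 0) => //.
    by move/null_content_dominatesP: Qa_dom => /(_ N mN ON).
  have [K [mK K0 FK]] := e_sing O.
  by apply: subset_measure0 K0 => // y [/eqP Fy _]; exact: FK.
move=> e' [[me' e'0] e'P] _ wde wde'.
have mUe := utility_measurable U_utility e_meas e_ge0.
have mUe' := utility_measurable U_utility me' e'0.
(* Both expectations are split into positive and negative parts, whose
   integrals are computed orbit by orbit off N. *)
rewrite integralE [leRHS]integralE.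
apply: sube_le_of_swap => //; do ?exact: integral_ge0.
rewrite !int_QMa//; do ?[exact: measurable_funepos|exact: measurable_funeneg].
have mint (f : borel Y -> \bar R) : measurable_fun setT f ->
    (forall y, 0 <= f y) ->
    measurable_fun [set: borel (orbit_space a)]
      (fun O => \int[Q O]_(y in ~` N) f y).
  move=> mf f0; have mfN : measurable_fun setT (f \_ (~` N)).
    exact: (measurable_restrictT f mCN).1 (measurable_funTS mf).
  have fN0 y : 0 <= (f \_ (~` N)) y by rewrite patchE; case: ifP.
  apply: eq_measurable_fun (measurable_integral_pker Q mfN fN0) => O _.
  by rewrite [RHS]integral_mkcond.
rewrite -!ge0_integralD//;
  do ?[by move=> O _; exact: integral_ge0
      |apply: mint => //; exact: measurable_funepos
      |apply: mint => //; exact: measurable_funeneg].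
have mD (f g : borel Y -> \bar R) :
    measurable_fun setT f -> measurable_fun setT g ->
    (forall y, 0 <= f y) -> (forall y, 0 <= g y) ->
    measurable_fun [set: borel (orbit_space a)]
      (fun O => \int[Q O]_(y in ~` N) f y + \int[Q O]_(y in ~` N) g y).
  by move=> mf mg f0 g0; apply: emeasurable_funD; exact: mint.
apply: ae_ge0_le_integral => //;
  do ?[by move=> O _; apply: adde_ge0; exact: integral_ge0
      |by apply: mD => //; [exact: measurable_funepos|exact: measurable_funeneg]].
have [M [mM M0 NM]] := unifN.
exists M; split=> // O /= QO; apply: NM => /= ON; apply: QO => _.
have [l [l0 emax]] := e_argmax O.
apply: (decomposition_integral_le (Q_dec O) mN ON U_utility l0 e_meas e_ge0 me'
  e'0 (e_unif O) _ emax (e_sing O)).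
exact: (e'P _ (unif_invariant haarP O)).
Qed.
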